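(* Let $G$ be a $3$-connected graph. If $\sigma_2(G)\ge 2\widetilde{\alpha}(G)+1$, then $G$ is hamiltonian-connected, i.e., for every two distinct vertices $x,y$ of $G$ there is a path from $x$ to $y$ containing every vertex of $G$.
   Context: All graphs are finite and simple. For a graph $G$ that is not complete, $\sigma_2(G)=\min\{d_G(u)+d_G(v): u,v\in V(G),\ u\ne v,\ uv\notin E(G)\}$; if $G$ is complete, $\sigma_2(G)=\infty$. An $(s,t)$-bipartite-hole in $G$ consists of two disjoint vertex sets $S,T\subseteq V(G)$ with $|S|=s$, $|T|=t$ and no edge of $G$ having one endpoint in $S$ and the other in $T$. The bipartite-hole-number $\widetilde{\alpha}(G)$ is the minimum integer $k$ such that there exist positive integers $s,t$ with $s+t=k+1$ for which $G$ contains no $(s,t)$-bipartite-hole. *)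

(* Defs.v *)
From mathcomp Require Import all_boot.
Set Implicit Arguments. Unset Strict Implicit. Unset Printing Implicit Defensive.

Section Graph.
Variables (V : finType) (e : rel V).

Definition simple_graph : Prop := symmetric e /\ irreflexive e.

Definition deg (u : V) : nat := #|[set v | e u v]|.

Definition is_complete : bool :=
  [forall u, forall v, (u != v) ==> e u v].

(* sigma_2(G): None encodes +infinity (G complete). The big min has an
   initial value 2*#|V| exceeding every degree sum, so it is the true min
   whenever the range is nonempty. *)
Definition sigma2 : option nat :=
  if is_complete then None
  else Some (\big[minn/(2 * #|V|)%N]_(p : V * V | (p.1 != p.2) && ~~ e p.1 p.2)
               (deg p.1 + deg p.2)).

Definition le_ext (k : nat) (s : option nat) : bool :=
  if s is Some s' then (k <= s')%N else true.

Definition has_bip_hole (s t : nat) : bool :=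
  [exists S : {set V}, exists T : {set V},
    [&& [disjoint S & T], #|S| == s, #|T| == t &
        [forall x in S, forall y in T, ~~ e x y]]].

Definition bhn_pred (k : nat) : bool :=
  [exists s : 'I_k.+2, exists t : 'I_k.+2,
    [&& (0 < s)%N, (0 < t)%N, (s + t == k.+1)%N & ~~ has_bip_hole s t]].

Lemma bhn_exists : exists k, bhn_pred k.
Proof.
exists #|V|.+1; apply/existsP; exists (inord 1); apply/existsP.
exists (inord #|V|.+1).
rewrite !inordK //= add1n eqxx /=; apply/negP => /existsP [S /existsP [T /and4P [_ _ /eqP HT _]]].
by move: (max_card T); rewrite HT ltnn.
Qed.

Definition bhn : nat := ex_minn bhn_exists.

Definition connected_on (A : {set V}) : Prop :=
  forall u v, u \in A -> v \in A ->
    connect [rel a b | [&& e a b, a \in A & b \in A]] u v.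

Definition k_connected (k : nat) : Prop :=
  (k < #|V|)%N /\ forall S : {set V}, (#|S| < k)%N -> connected_on (~: S).

Definition ham_path (x y : V) (p : seq V) : Prop :=
  [/\ path e x p, last x p = y, uniq (x :: p) & forall v, v \in x :: p].

Definition hamiltonian_connected : Prop :=
  forall x y, x != y -> exists p, ham_path x y p.

End Graph.

(* Main.v *)
Require Import Defs.
From mathcomp Require Import all_boot.
From mathcomp Require Import zify.
Set Implicit Arguments. Unset Strict Implicit. Unset Printing Implicit Defensive.

(** Take s + t = bhn + 1 with no (s,t)-bipartite-hole, and fix x and y.

    Closure step: let u, v be nonadjacent, both of degree at least s + t, and
    let G + uv have a Hamiltonian x-y path. If it uses uv, reconnecting its two
    halves by xy gives a Hamiltonian path of G + xy from v to u through xy.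
    As in the argument of McDiarmid and Yolov, rotating both ends of this path
    at suitably chosen neighbours of u and v yields an (s,t)-hole, unless some
    pair of rotated ends is adjacent and closes a Hamiltonian cycle through xy,
    that is, a Hamiltonian x-y path of G. The rotations must not break xy; this
    costs at most one neighbour of each end, which the degree s + t affords.

    Adding edges preserves the other hypotheses, so one may assume that the
    vertices of degree at least s + t form a clique. By the bound on sigma_2
    the remaining vertices form a clique too, and a 3-connected graph covered by
    two disjoint cliques is hamiltonian-connected by direct construction. *)

(** * Ends, reversal and splitting of sorted sequences *)

Section Sequences.
Variable T : eqType.
Implicit Types (r : rel T) (s t : seq T) (d : T).

Lemma sorted_cat r d s t :
  sorted r s -> sorted r t -> r (last d s) (head d t) -> sorted r (s ++ t).
Proof.
case: s => [//|a s]; case: t => [|b t]; first by rewrite cats0.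
by rewrite /= cat_path /= => -> -> ->.
Qed.

Lemma last_rev d s : last d (rev s) = head d s.
Proof. by case: s => [//|a s]; rewrite rev_cons last_rcons. Qed.

Lemma head_rev d s : head d (rev s) = last d s.
Proof. by rewrite -last_rev revK. Qed.

Lemma sorted_sym_rev r s : symmetric r -> sorted r s -> sorted r (rev s).
Proof.
by move=> r_sym; rewrite rev_sorted; apply: sub_sorted => a b; rewrite r_sym.
Qed.

Lemma not_sorted_split r s :
  ~~ sorted r s ->
  exists s1 a b s2, s = rcons s1 a ++ b :: s2 /\ ~~ r a b.
Proof.
elim: s => [//|a [//|b s] IH] /=; rewrite negb_and => /orP[nab|np].
  by exists [::], a, b, s.
have [s1 [a' [b' [s2 [-> nab]]]]] := IH np.
by exists (a :: s1), a', b', s2.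
Qed.

Lemma infix_nth2 d c s : c.+1 < size s -> infix [:: nth d s c; nth d s c.+1] s.
Proof.
move=> lt_c; rewrite -{3}(cat_take_drop c s) (drop_nth d) ?(ltnW lt_c) //.
by rewrite (drop_nth d lt_c); apply/infixP; exists (take c s), (drop c.+2 s).
Qed.

End Sequences.

(** * Paths in a graph with one added edge *)

Section AddEdge.
Variables (V : finType) (e : rel V).
Hypothesis e_simple : simple_graph e.
Let e_sym : symmetric e := proj1 e_simple.

Definition add_edge (u v : V) : rel V :=
  [rel a b | [|| e a b, (a == u) && (b == v) | (a == v) && (b == u)]].

Lemma add_edge_sym u v : symmetric (add_edge u v).
Proof. by move=> a b; rewrite /add_edge /= e_sym; do !case: eqP => //=; rewrite ?orbT. Qed.

Lemma sub_add_edge u v : subrel e (add_edge u v).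
Proof. by move=> a b; rewrite /add_edge /= => ->. Qed.

(** The new edge needs both of its ends on the path. *)
Lemma sorted_add_edge u v s :
  sorted (add_edge u v) s -> (u \notin s) || (v \notin s) -> sorted e s.
Proof.
elim: s => [//|a [//|b s] IH]; rewrite [sorted _ _]/= {1}/add_edge /=.
move=> /andP[/or3P eab p] uvs.
have -> /= : e a b.
  case: eab => // /andP[/eqP ? /eqP ?]; subst;
    by move: uvs; rewrite !inE !eqxx ?orbT.
by apply: IH => //; move: uvs; rewrite !(in_cons a) !negb_or -!/(_ \in b :: s);
   case/orP => /andP[_ ->]; rewrite ?orbT.
Qed.

(** Without repetitions the new edge is used at most once. Cut there, each half misses one of its
    ends and so stays inside [e]. *)
Lemma sorted_add_edge_split u v s :
    uniq s -> sorted (add_edge u v) s -> ~~ sorted e s ->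
  exists s1 a b s2, [/\ s = rcons s1 a ++ b :: s2,
    sorted e (rcons s1 a), sorted e (b :: s2) &
    (a, b) = (u, v) \/ (a, b) = (v, u)].
Proof.
move=> Us sorted_s /not_sorted_split [s1 [a [b [s2 [def_s nab]]]]].
move: Us sorted_s; rewrite {}def_s => Us.
have na : a \notin b :: s2.
  by move: Us; rewrite cat_uniq => /and3P[_ /hasPn h _]; apply: contraL (mem_head a s1) => /h;
    rewrite /= mem_rcons inE eqxx.
have nb : b \notin rcons s1 a.
  by move: Us; rewrite cat_uniq => /and3P[_ /hasPn h _]; apply: h; rewrite mem_head.
move=> /[dup] /cat_sorted2[sr1 sr2]; rewrite cat_rcons.
case/cat_sorted2=> _; rewrite [sorted _ _]/= {1}/add_edge /= (negPf nab) /=.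
case/andP=> /orP eab _.
exists s1, a, b, s2; split; rewrite ?cat_rcons //.
- by apply: (sorted_add_edge sr1); case: eab => /andP[/eqP ? /eqP ?]; subst; rewrite nb ?orbT.
- by apply: (sorted_add_edge sr2); case: eab => /andP[/eqP ? /eqP ?]; subst; rewrite na ?orbT.
- by case: eab => /andP[/eqP-> /eqP->]; [left|right].
Qed.

(* A Hamiltonian cycle of G + xy through the edge xy, cut open at an edge of G. *)
Lemma ham_path_of_cycle x y d s :
    x != y -> uniq s -> (forall v, v \in s) -> sorted (add_edge x y) s ->
    e (last d s) (head d s) -> infix [:: y; x] s || infix [:: x; y] s ->
  exists p, ham_path e x y p.
Proof.
move=> nxy Us Ts sorted_s closed_s inf_s.
wlog inf_yx : s Us Ts sorted_s closed_s {inf_s} / infix [:: y; x] s => [W|].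
  case/orP: inf_s => [|inf_xy]; first exact: W.
  apply: (W (rev s)); first by rewrite rev_uniq.
  - by move=> v; rewrite mem_rev.
  - exact: (sorted_sym_rev (add_edge_sym x y)).
  - by rewrite last_rev head_rev e_sym.
  - by rewrite -infix_rev revK.
case/infixP: inf_yx => s1 [s2 def_s].
have {}def_s : s = rcons s1 y ++ x :: s2 by rewrite def_s cat_rcons.
move: Us Ts sorted_s closed_s; rewrite {}def_s => Us Ts /cat_sorted2[sr1 sr2].
rewrite last_cat /= => cl.
have ny : y \notin x :: s2.
  by move: Us; rewrite cat_uniq => /and3P[_ /hasPn h _]; apply/negP=> /h;
    rewrite /= mem_rcons inE eqxx.
have nx : x \notin rcons s1 y.
  by move: Us; rewrite cat_uniq => /and3P[_ /hasPn h _]; apply: h; rewrite mem_head.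
(* Read the cycle from [x] through the closing edge round to [y]. Neither half contains both [x] and
   [y], so both halves lie in [e]. *)
exists (s2 ++ rcons s1 y); split.
- rewrite -[path _ _ _]/(sorted e ((x :: s2) ++ rcons s1 y)).
  apply: (@sorted_cat _ _ d); last by case: (s1) cl.
  + by apply: (sorted_add_edge sr2); rewrite ny orbT.
  + by apply: (sorted_add_edge sr1); rewrite nx.
- by rewrite last_cat last_rcons.
- by rewrite -cat_cons uniq_catC.
- by move=> v; move: (Ts v); rewrite -cat_cons !mem_cat orbC.
Qed.

End AddEdge.

(** * Bipartite holes from indexed families *)

Section Holes.
Variables (V : finType) (e : rel V).

Lemma card_subset_exists (T : finType) (A : {set T}) m :
  m <= #|A| -> exists2 B : {set T}, B \subset A & #|B| = m.
Proof.
case/card_geqP=> s [Us <- sA]; exists [set x in s].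
  by apply/subsetP => x; rewrite inE => /sA.
by rewrite cardsE; apply/card_uniqP.
Qed.

(** Holes shrink to smaller holes, so lower bounds on the index sets suffice. The index maps allow
    rotated ends to be named by positions on a path. *)
Lemma has_bip_hole_imset (T1 T2 : finType) (f : T1 -> V) (g : T2 -> V)
    (I : {set T1}) (J : {set T2}) s t :
    {in I &, injective f} -> {in J &, injective g} ->
    {in I & J, forall i j, (f i != g j) && ~~ e (f i) (g j)} ->
    s <= #|I| -> t <= #|J| ->
  has_bip_hole e s t.
Proof.
move=> injf injg fg /card_subset_exists[I' sI <-] /card_subset_exists[J' sJ <-].
apply/existsP; exists (f @: I'); apply/existsP; exists (g @: J').
rewrite !card_in_imset ?eqxx /=; last first.
- by move=> i j /(subsetP sI) ? /(subsetP sI); apply: injf.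
- by move=> i j /(subsetP sJ) ? /(subsetP sJ); apply: injg.
apply/andP; split.
  rewrite disjoint_subset; apply/subsetP => v /imsetP[i /(subsetP sI) Ii ->].
  rewrite inE; apply/imsetP => -[j /(subsetP sJ) Jj /eqP].
  by case/andP: (fg _ _ Ii Jj) => /negPf->.
apply/forall_inP => _ /imsetP[i /(subsetP sI) Ii ->].
apply/forall_inP => _ /imsetP[j /(subsetP sJ) Jj ->].
by case/andP: (fg _ _ Ii Jj).
Qed.

End Holes.

(** * Rotating a Hamiltonian path through a prescribed edge *)

Section Rotation.
Variables (V : finType) (e : rel V) (x y d : V) (Q : seq V) (c : nat).
Hypotheses (e_simple : simple_graph e) (nxy : x != y).
Hypotheses (uniqQ : uniq Q) (memQ : forall v, v \in Q).
Hypothesis sortedQ : sorted (add_edge e x y) Q.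
Hypotheses (lt_c : c.+1 < size Q) (Qc : nth d Q c = y) (Qc1 : nth d Q c.+1 = x).
Local Notation q := (nth d Q).
Local Notation n := (size Q).
Let e_sym : symmetric e := proj1 e_simple.

Definition slice i j := take (j - i) (drop i Q).

(** Both orientations are allowed because rotations reverse slices. *)
Definition traverses s := infix [:: y; x] s || infix [:: x; y] s.

Lemma slice_infix i j : i <= c -> c.+1 < j <= n -> traverses (slice i j).
Proof.
move=> le_ic /andP[lt_cj le_jn]; apply/orP; left.
have sz : size (slice i j) = j - i by rewrite size_takel // size_drop leq_sub2r.
have nthS k : k < j - i -> nth d (slice i j) k = q (i + k).
  by move=> lt_k; rewrite nth_take // nth_drop.
have := @infix_nth2 _ d (c - i) (slice i j); rewrite sz !nthS; [|lia|lia].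
by rewrite addnS subnKC // Qc Qc1; apply; lia.
Qed.

Lemma slice_sorted i j : sorted (add_edge e x y) (slice i j).
Proof. exact: take_sorted (drop_sorted _ sortedQ). Qed.

Lemma slice_head i j : i < j -> head d (slice i j) = q i.
Proof. by move=> lt_ij; rewrite -nth0 nth_take ?subn_gt0 // nth_drop addn0. Qed.

Lemma slice_last i j : i < j <= n -> last d (slice i j) = q j.-1.
Proof.
move=> /andP[lt_ij le_jn].
have sz : size (slice i j) = j - i by rewrite size_takel // size_drop leq_sub2r.
by rewrite -nth_last sz nth_take ?nth_drop; [congr nth|]; lia.
Qed.

Lemma slice3 i j : i <= j <= n -> Q = slice 0 i ++ slice i j ++ slice j n.
Proof.
case/andP=> le_ij le_jn; rewrite /slice subn0 drop0.
rewrite -{1}(cat_take_drop i Q); congr (_ ++ _).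
rewrite -{1}(cat_take_drop (j - i) (drop i Q)); congr (_ ++ _).
by rewrite drop_drop subnK // [RHS]take_oversize // size_drop.
Qed.

Lemma traverses_rev s : traverses (rev s) = traverses s.
Proof. by rewrite /traverses -!(infix_revLR _ s) /rev /= orbC. Qed.

Lemma traverses_cat s1 s2 : traverses s1 || traverses s2 -> traverses (s1 ++ s2).
Proof.
by case/orP=> /orP[h|h]; rewrite /traverses ?(infix_catr _ h) ?(infix_catl _ h) ?orbT.
Qed.

Hypothesis no_ham : ~ exists p, ham_path e x y p.

Lemma closed_nonadj s :
    perm_eq s Q -> sorted (add_edge e x y) s -> traverses s ->
  ~~ e (last d s) (head d s).
Proof.
move=> sQ sorted_s inf_s; apply/negP => closed_s; apply: no_ham.
apply: (@ham_path_of_cycle _ _ e_simple x y d s) => //.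
  by rewrite (perm_uniq sQ).
by move=> v; rewrite (perm_mem sQ).
Qed.

Let a_sym := add_edge_sym e_simple x y.
Let sub_a := @sub_add_edge _ e x y.

(** Recording the ends of a nonempty piece reduces gluing to one adjacency. *)
Definition segment s a b :=
  [/\ s != [::], head d s = a, last d s = b & sorted (add_edge e x y) s].

Lemma segment_slice i j : i < j <= n -> segment (slice i j) (q i) (q j.-1).
Proof.
move=> ij; split; [|exact: slice_head (proj1 (andP ij))|exact: slice_last|exact: slice_sorted].
rewrite -size_eq0 size_takel; first by lia.
by rewrite size_drop leq_sub2r //; case/andP: ij.
Qed.

Lemma segment_rev s a b : segment s a b -> segment (rev s) b a.
Proof.
case=> ns <- <- ss; split; rewrite ?head_rev ?last_rev //; last exact: sorted_sym_rev.
by rewrite -size_eq0 size_rev size_eq0.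
Qed.

Lemma segment_cat s1 s2 a1 b1 a2 b2 :
  segment s1 a1 b1 -> segment s2 a2 b2 -> e b1 a2 -> segment (s1 ++ s2) a1 b2.
Proof.
move=> [n1 <- <- so1] [n2 <- <- so2] e12; split.
- by case: (s1) n1.
- by case: (s1) n1.
- by rewrite last_cat; case: (s2) n2.
- by apply: (@sorted_cat _ _ d) => //; apply: sub_a.
Qed.

(** Each rotation reorders three slices of the path. An edge closing them up would give a
    Hamiltonian cycle through [xy], hence the excluded Hamiltonian path from [x] to [y]. *)
Lemma closed3_nonadj s1 s2 s3 a1 b1 a2 b2 a3 b3 :
    segment s1 a1 b1 -> segment s2 a2 b2 -> segment s3 a3 b3 ->
    e b1 a2 -> e b2 a3 -> perm_eq (s1 ++ s2 ++ s3) Q ->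
    [|| traverses s1, traverses s2 | traverses s3] ->
  ~~ e b3 a1.
Proof.
move=> g1 g2 g3 e12 e23 pQ inf.
have [_ <- <- so] := segment_cat g1 (segment_cat g2 g3 e23) e12.
apply: closed_nonadj => //.
by case/or3P: inf => h; apply: traverses_cat; rewrite ?h // traverses_cat ?h ?orbT.
Qed.

(** The edge [xy] occupies positions [c] and [c.+1], so only a cut just before [c.+1] can break
    it. *)
Lemma slice3_infix i j : 0 < i <= j -> j < n -> i != c.+1 -> j != c.+1 ->
  [|| traverses (slice 0 i), traverses (slice i j) | traverses (slice j n)].
Proof.
move=> ij jn ni nj; apply/or3P.
have [h|h] := ltnP c.+1 i; first by apply: Or31; apply: slice_infix; lia.
have [h'|h'] := ltnP c.+1 j; first by apply: Or32; apply: slice_infix; lia.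
by apply: Or33; apply: slice_infix; lia.
Qed.

(* The cycle [q (i-1) .. q 0, q i .. q j, q (n-1) .. q (j+1)]. *)
Lemma rotation_cross i j :
    0 < i <= j -> j.+1 < n -> i != c.+1 -> j != c ->
    e (q 0) (q i) -> e (q n.-1) (q j) ->
  ~~ e (q i.-1) (q j.+1).
Proof.
move=> ij lt_jn nic njc ei ej; rewrite e_sym.
apply: (@closed3_nonadj (rev (slice 0 i)) (slice i j.+1) (rev (slice j.+1 n))).
- by apply/segment_rev/segment_slice; lia.
- by apply: segment_slice; lia.
- by apply/segment_rev/segment_slice; lia.
- by [].
- by rewrite e_sym.
- rewrite [X in perm_eq _ X](@slice3 i j.+1); last by lia.
  by rewrite perm_cat ?perm_rev // perm_cat ?perm_rev.
- by rewrite !traverses_rev slice3_infix; lia.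
Qed.

(* The cycle [q (i+1) .. q (n-1), q j .. q 0, q i .. q (j+1)]. *)
Lemma rotation_succ i j :
    j < i -> i.+1 < n -> i != c -> j != c ->
    e (q 0) (q i) -> e (q n.-1) (q j) ->
  ~~ e (q i.+1) (q j.+1).
Proof.
move=> ij lt_in nic njc ei ej; rewrite e_sym.
apply: (@closed3_nonadj (slice i.+1 n) (rev (slice 0 j.+1)) (rev (slice j.+1 i.+1))).
- by apply: segment_slice; lia.
- by apply/segment_rev/segment_slice; lia.
- by apply/segment_rev/segment_slice; lia.
- by [].
- by [].
- rewrite [X in perm_eq _ X](@slice3 j.+1 i.+1); last by lia.
  by rewrite perm_catC -catA perm_cat ?perm_rev // perm_cat ?perm_rev.
- by rewrite !traverses_rev orbC -orbA slice3_infix; lia.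
Qed.

(* The cycle [q (j-1) .. q 0, q i .. q (n-1), q j .. q (i-1)]. *)
Lemma rotation_pred i j :
    0 < j < i -> i < n -> i != c.+1 -> j != c.+1 ->
    e (q 0) (q i) -> e (q n.-1) (q j) ->
  ~~ e (q i.-1) (q j.-1).
Proof.
move=> ij lt_in nic njc ei ej.
apply: (@closed3_nonadj (rev (slice 0 j)) (slice i n) (slice j i)).
- by apply/segment_rev/segment_slice; lia.
- by apply: segment_slice; lia.
- by apply: segment_slice; lia.
- by [].
- by [].
- rewrite [X in perm_eq _ X](@slice3 j i); last by lia.
  by rewrite perm_cat ?perm_rev // perm_catC.
- by rewrite !traverses_rev [traverses (slice i n) || _]orbC slice3_infix; lia.
Qed.

Lemma size_ham : n = #|V|.
Proof. by rewrite -(card_uniqP uniqQ); apply: eq_card => v; rewrite memQ. Qed.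

Lemma deg_nth v : deg e v = #|[set i : 'I_n | e v (q i)]|.
Proof.
have qinj : injective (fun i : 'I_n => q i).
  by move=> i j /eqP; rewrite nth_uniq // => /eqP/val_inj.
rewrite /deg -(card_imset _ qinj); apply: eq_card => w; rewrite inE.
apply/idP/imsetP => [evw|[i]]; last by rewrite inE => evi ->.
have iw : index w Q < n by rewrite index_mem.
by exists (Ordinal iw); rewrite ?inE /= nth_index.
Qed.

Lemma ham_endpoints_bip_hole s t :
    0 < s -> 0 < t -> ~~ e (q 0) (q n.-1) ->
    s + t <= deg e (q 0) -> s + t <= deg e (q n.-1) ->
  has_bip_hole e s t.
Proof.
move=> s0 t0 nadj degA degB.
have nbr v k : k <= deg e v ->
    exists2 A : {set 'I_n}, (forall i, (i \in A) = e v (q i)) & k <= #|A|.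
  by rewrite deg_nth => le_k; exists [set i : 'I_n | e v (q i)] => // i; rewrite inE.
have [A memA {}degA] := nbr _ _ degA; have [B memB {}degB] := nbr _ _ degB.
have Apos (i : 'I_n) : i \in A -> e (q 0) (q i) /\ 0 < i < n.-1.
  rewrite memA => ei; split=> //; have := ltn_ord i.
  case: (posnP i) ei => [-> |]; first by rewrite (proj2 e_simple).
  by case: (eqVneq (i : nat) n.-1) => [-> _|]; [rewrite (negPf nadj)|lia].
have Bpos (j : 'I_n) : j \in B -> e (q n.-1) (q j) /\ 0 < j < n.-1.
  rewrite memB => ej; split=> //; have := ltn_ord j.
  case: (posnP j) ej => [-> |]; first by rewrite e_sym (negPf nadj).
  by case: (eqVneq (j : nat) n.-1) => [-> _|]; [rewrite (proj2 e_simple)|lia].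
have qinj a b : q a = q b -> a < n -> b < n -> a = b.
  by move=> eq_q lta ltb; apply/eqP; rewrite -(nth_uniq d lta ltb uniqQ) eq_q.
(* [k] is the position whose crossing rotation would break [xy]. A neighbour of [q 0] is cut from
   its predecessor, which excludes [c.+1]; a neighbour of [q n.-1] is cut from its successor, which
   excludes [c]. *)
pose cut (C : {set 'I_n}) (P : pred nat) k := [set i in C | P i && (i != k :> nat)].
have card_cut (C : {set 'I_n}) (P : pred nat) k : #|C| <= #|cut C P k| + #|cut C (predC P) k| + 1.
  pose K := [set i : 'I_n | i == k :> nat].
  have leK : #|K| <= 1 by apply/card_le1P => i; rewrite inE => /eqP ik j; rewrite !inE -ik.
  have leC : #|C| <= #|cut C P k :|: cut C (predC P) k :|: K|.
    apply/subset_leq_card/subsetP=> i iC; rewrite !inE iC /=.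
    by case: (P i); case: eqP.
  have [le1 _] := leq_card_setU (cut C P k :|: cut C (predC P) k) K.
  have [le2 _] := leq_card_setU (cut C P k) (cut C (predC P) k).
  exact: leq_trans (leq_trans leC le1) (leq_add le2 leK).
have inA P (i : 'I_n) : i \in cut A P c.+1 ->
    [/\ e (q 0) (q i), 0 < i < n.-1, P i & i != c.+1 :> nat].
  by rewrite in_set => /andP[/Apos[? ?] /andP[]].
have inB P (j : 'I_n) : j \in cut B P c ->
    [/\ e (q n.-1) (q j), 0 < j < n.-1, P j & j != c :> nat].
  by rewrite in_set => /andP[/Bpos[? ?] /andP[]].
pose inner := [pred i : 'I_n | 0 < i < n.-1].
have inj_pred : {in inner &, injective (fun i : 'I_n => q i.-1)}.
  by move=> i j; rewrite !inE => ? ? /qinj H; apply: val_inj => /=; lia.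
have inj_succ : {in inner &, injective (fun i : 'I_n => q i.+1)}.
  by move=> i j; rewrite !inE => ? ? /qinj H; apply: val_inj => /=; lia.
(* [p] splits the path so that [q 0] has [s] usable neighbours up to position
   [p]. If [q (n-1)] has [t] usable ones from [p] on, crossing rotations give the
   hole; otherwise [s] of them lie before [p], [t] usable neighbours of [q 0] lie
   from [p] on, and one shifts all of them away from the edge [xy]. *)
have exP : exists p, s <= #|cut A (ltn^~ p) c.+1|.
  (* All positions are below [n], and at least [s + t - 1 >= s] of them are usable. *)
  exists n; have := card_cut A (ltn^~ n) c.+1.
  rewrite [#|cut A (predC _) _|]eq_card0; first by lia.
  by move=> i; rewrite !inE /= ltn_ord /= andbF.
(* The minimum is [p.+1]: positions up to [p] reach [s], those below [p] do not. It is nonzero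
   because [s] is positive. *)
case: (ex_minnP exP) => -[|p] leA minp.
  by case/card_gt0P: (leq_trans s0 leA) => i /inA[].
have ltA : #|cut A (ltn^~ p) c.+1| < s.
  by rewrite ltnNge; apply/negP => /minp; rewrite ltnn.
have := card_cut A (ltn^~ p) c.+1; have := card_cut B (ltn^~ p) c.
have [leB _ _|ltB cutB cutA] := leqP t #|cut B (predC (ltn^~ p)) c|.
  apply: (has_bip_hole_imset _ _ _ leA leB).
  - by apply: sub_in2 inj_pred => i /inA[].
  - by apply: sub_in2 inj_succ => j /inB[].
  - move=> i j /inA[ei ? /= ? ?] /inB[ej ? /= ? ?].
    rewrite rotation_cross ?andbT //; try lia.
    by apply/eqP => /qinj; lia.
(* The count is exact: [s + t], minus the dropped position, minus at most [t - 1], leaves [s];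
   symmetrically [t] remain for [A]. *)
have leB : s <= #|cut B (ltn^~ p) c| by lia.
have {}leA : t <= #|cut A (predC (ltn^~ p)) c.+1| by lia.
(* Shifting to successors forbids [c] at both ends, and shifting to predecessors forbids [c.+1]. For
   each shift, [cut] handles one end, and the side of [p] on which [c] lies handles the other. *)
have [lt_cp|le_pc] := ltnP c p; apply: (has_bip_hole_imset _ _ _ leB leA).
- by apply: sub_in2 inj_succ => i /inB[].
- by apply: sub_in2 inj_succ => j /inA[].
- move=> j i /inB[ej ? /= ? ?] /inA[ei ? /= ? ?].
  rewrite e_sym rotation_succ ?andbT //; try lia.
  by apply/eqP => /qinj; lia.
- by apply: sub_in2 inj_pred => i /inB[].
- by apply: sub_in2 inj_pred => j /inA[].
- move=> j i /inB[ej ? /= ? ?] /inA[ei ? /= ? ?].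
  rewrite e_sym rotation_pred ?andbT //; try lia.
  by apply/eqP => /qinj; lia.
Qed.

End Rotation.

(** * The closure step and monotonicity under adding edges *)

Section Closure.
Variables (V : finType) (e : rel V).
Hypothesis e_simple : simple_graph e.

(** The length of a Hamiltonian path is fixed, so the search is finite. This allows arguing by
    contradiction without a classical axiom. *)
Lemma ham_path_dec x y : decidable (exists p, ham_path e x y p).
Proof.
pose ham (p : #|V|.-1.-tuple V) :=
  [&& path e x p, last x p == y, uniq (x :: p) & [forall v, v \in x :: p]].
case: (boolP [exists p, ham p]) => [/existsP H|/existsPn H]; [left|right].
  by have [p /and4P[? /eqP ? ? /forallP ?]] := H; exists p.
case=> p [e_p last_p Up Tp].
have size_p : size p == #|V|.-1.
  by rewrite -(size_ham Up Tp).
case/negP: (H (Tuple size_p)); apply/and4P; split=> //; first exact/eqP.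
exact/forallP.
Qed.

Lemma ham_path_add_edge u v x y s t p :
    x != y -> ~~ e u v -> 0 < s -> 0 < t -> ~~ has_bip_hole e s t ->
    s + t <= deg e u -> s + t <= deg e v ->
    ham_path (add_edge e u v) x y p ->
  exists p', ham_path e x y p'.
Proof.
move=> nxy nuv s0 t0 no_hole degu degv [path_p last_p Up Tp].
case: (ham_path_dec x y) => // no_ham.
case: (boolP (sorted e (x :: p))) => [sorted_p|]; first by exists p.
case/(sorted_add_edge_split Up path_p) => s1 [a [b [s2 [def_p so1 so2 ab]]]].
have [nab dega degb] : [/\ ~~ e b a, s + t <= deg e a & s + t <= deg e b].
  by case: ab => [[-> ->]|[-> ->]]; split=> //; rewrite (proj1 e_simple).
(* [Q] runs from [b] to [y], crosses [xy], then runs from [x] to [a]; its ends are the nonadjacent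
   [u] and [v]. *)
pose Q := (b :: s2) ++ rcons s1 a.
have pQ : perm_eq (x :: p) Q by rewrite def_p perm_catC.
have head_s1 : head x (rcons s1 a) = x by case: (s1) def_p => [|? ?] [->].
have last_s2 : last x (b :: s2) = y.
  by rewrite -last_p -[last x p]/(last x (x :: p)) def_p last_cat.
case/negP: no_hole.
have sizeQ : size Q = (size s2 + size s1).+2 by rewrite size_cat size_rcons addnS.
have Q_last : nth x Q (size Q).-1 = a by rewrite nth_last last_cat last_rcons.
(* [size s2] is the position of [y] in [Q], and [x] comes next. *)
apply: (@ham_endpoints_bip_hole V e x y x Q (size s2)) => //; rewrite ?Q_last //.
- by rewrite -(perm_uniq pQ).
- by move=> w; rewrite -(perm_mem pQ).
- apply: (@sorted_cat _ _ x); try exact: sub_sorted (@sub_add_edge _ e x y) _ _.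
  by rewrite head_s1 last_s2 /add_edge /= !eqxx !orbT.
- by rewrite sizeQ; lia.
- by rewrite nth_cat ltnS leqnn -last_s2 -[size s2]/(size (b :: s2)).-1 nth_last.
- by rewrite nth_cat ltnn subnn nth0.
Qed.

Lemma deg_add_edge u v w : deg e w <= deg (add_edge e u v) w.
Proof. by apply/subset_leq_card/subsetP=> z; rewrite !inE => /sub_add_edge. Qed.

Lemma add_edge_simple u v : u != v -> simple_graph (add_edge e u v).
Proof.
move=> nuv; split; first exact: add_edge_sym.
move=> w; rewrite /add_edge /= (proj2 e_simple) /=.
by case: (eqVneq w u) => [->|]; rewrite ?(negPf nuv) ?andbF.
Qed.

Lemma sub_has_bip_hole (e' : rel V) s t :
  subrel e e' -> has_bip_hole e' s t -> has_bip_hole e s t.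
Proof.
move=> ee' /existsP[S /existsP[T /and4P[dST cS cT /forall_inP h]]].
apply/existsP; exists S; apply/existsP; exists T; rewrite dST cS cT /=.
apply/forall_inP => a aS; apply/forall_inP => b bT.
by apply: contra (@ee' a b) _; move/forall_inP: (h a aS); apply.
Qed.

Lemma sub_k_connected (e' : rel V) k :
  subrel e e' -> k_connected e k -> k_connected e' k.
Proof.
move=> ee' [ltk conn]; split=> // S /conn cS a b aS bS.
apply: connect_sub (cS a b aS bS) => c d /and3P[/ee' ecd cc dd].
by apply: connect1; apply/and3P.
Qed.

End Closure.

(** * Graphs covered by two cliques *)

Section TwoCliques.
Variables (V : finType) (e : rel V).
Hypothesis e_simple : simple_graph e.

Definition clique (C : {set V}) := {in C &, forall u v, u != v -> e u v}.

Definition spanning_path (A : {set V}) a b :=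
  exists p, [/\ path e a p, last a p = b, uniq (a :: p) & a :: p =i A].

Lemma spanning_path_cat (A B : {set V}) a b c d :
    spanning_path A a b -> spanning_path B c d -> e b c -> [disjoint A & B] ->
  spanning_path (A :|: B) a d.
Proof.
move=> [p [ep lp Up Ap]] [r [er lr Ur Br]] ebc dAB; exists (p ++ c :: r); split.
- by rewrite cat_path ep lp /= ebc.
- by rewrite last_cat.
- rewrite -cat_cons cat_uniq Up Ur andbT; apply/hasPn => z; rewrite Br => zB.
  by rewrite /= Ap; apply: contraL zB => zA; rewrite (disjointFr dAB).
- by move=> z; rewrite -cat_cons mem_cat Ap Br inE.
Qed.

Lemma clique_path C a p :
  clique C -> uniq (a :: p) -> {subset a :: p <= C} -> path e a p.
Proof.
move=> cC; elim: p a => //= b p IH a /and3P[nab Ub Up] sub.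
rewrite IH ?andbT /= ?Ub //; last by move=> z z_p; apply: sub; rewrite inE z_p orbT.
apply: cC; [| |by move: nab; rewrite inE negb_or => /andP[]].
  by apply: sub; rewrite mem_head.
by apply: sub; rewrite !inE eqxx orbT.
Qed.

Lemma spanning_path1 a : spanning_path [set a] a a.
Proof. by exists [::]; split=> // z; rewrite !inE. Qed.

(** The remaining vertices of a clique may be visited in any order. Coinciding ends require a
    one-vertex clique. *)
Lemma clique_spanning_path C a b :
    clique C -> a \in C -> b \in C -> (a = b -> C = [set a]) ->
  spanning_path C a b.
Proof.
move=> cC aC bC; case: (eqVneq a b) => [<- /(_ erefl) ->|nab _].
  exact: spanning_path1.
have memp : a :: rcons (enum (C :\ a :\ b)) b =i C.
  move=> z; rewrite in_cons mem_rcons in_cons mem_enum !inE.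
  by case: (eqVneq z a) => [->|] //; case: (eqVneq z b) => [->|].
have Up : uniq (a :: rcons (enum (C :\ a :\ b)) b).
  by rewrite /= rcons_uniq mem_rcons in_cons !mem_enum enum_uniq !inE !eqxx (negPf nab) andbF.
exists (rcons (enum (C :\ a :\ b)) b); split=> //; last by rewrite last_rcons.
by apply: clique_path cC Up _ => z; rewrite memp.
Qed.

Hypothesis e_conn : k_connected e 3.

(** Deleting [S] leaves the graph connected. Without such an edge, [H] would be closed under
    adjacency outside [S], and [a0] could not reach [b0]. *)
Lemma cross_edge (H S : {set V}) a0 b0 :
    #|S| < 3 -> a0 \in H -> a0 \notin S -> b0 \notin H -> b0 \notin S ->
  exists a b, [/\ a \in H, a \notin S, b \notin H, b \notin S & e a b].
Proof.
move=> cS a0H a0S b0H b0S.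
have [/existsP[a /existsP[b /and5P[? ? ? ? ?]]]|/existsPn none] :=
  boolP [exists a, exists b, [&& a \in H, a \notin S, b \notin H, b \notin S & e a b]].
  by exists a, b.
have noab a b : a \in H -> a \notin S -> b \notin H -> b \notin S -> e a b -> False.
  by move=> aH aS bH bS eab; move/existsPn/(_ b): (none a); rewrite aH aS bH bS eab.
suff cl : closed [rel a b | [&& e a b, a \in ~: S & b \in ~: S]] (mem H).
  have /(closed_connect cl) : connect [rel a b | [&& e a b, a \in ~: S & b \in ~: S]] a0 b0.
    by apply: (proj2 e_conn) => //; rewrite inE.
  by rewrite a0H (negPf b0H).
move=> a b /= /and3P[eab]; rewrite !inE => aS bS; apply/idP/idP => [aH|bH].
  by apply/negPn/negP => bH; apply: (noab a b).
by apply/negPn/negP => aH; apply: (noab b a) => //; rewrite (proj1 e_simple).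
Qed.

Lemma spanning_path_ham x y : spanning_path setT x y -> exists p, ham_path e x y p.
Proof. by case=> p [? ? ? Tp]; exists p; split=> // v; rewrite Tp inE. Qed.

(** Take [x] in [H]. If [y] is outside, one crossing edge joins a path of each clique. If [y] is in
    [H] and the other clique is nonempty, the path leaves [H], sweeps the other clique and returns,
    which takes two crossing edges with distinct ends in [H]. *)
Lemma two_cliques_ham H x y :
  clique H -> clique (~: H) -> x != y -> exists p, ham_path e x y p.
Proof.
move=> + + nxy; wlog xH : H / x \in H => [W|cH cL].
  case: (boolP (x \in H)) => [xH|xL]; first exact: W.
  by move=> cH cL; apply: (W (~: H)); rewrite ?inE // setCK.
apply: spanning_path_ham.
have disjL (A : {set V}) : A \subset H -> [disjoint A & ~: H].
  by rewrite disjoints_subset setCK.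
have neq1 (A : {set V}) z : z \in A -> A != [set z] -> exists2 z', z' \in A & z' != z.
  move=> zA nA; suff /set0Pn[z'] : A :\ z != set0 by rewrite !inE => /andP[? ?]; exists z'.
  by apply: contra nA => /eqP Az; rewrite -(setD1K zA) Az setU0.
have cards_lt3 (z z' : V) : #|[set z; z']| < 3 by rewrite cards2; case: (_ != _).
have [yH|yL] := boolP (y \in H); last first.
  (* An end of the path may carry the crossing edge only if it is alone in its clique; otherwise it
     is deleted. *)
  pose S := [set z | (z == x) && (H != [set x]) || (z == y) && (~: H != [set y])].
  have cS : #|S| < 3.
    apply: leq_ltn_trans (cards_lt3 x y); apply/subset_leq_card/subsetP => z.
    by rewrite !inE => /orP[/andP[-> _]|/andP[-> _]]; rewrite ?orbT.
  have [a0 a0H a0S] : exists2 a0, a0 \in H & a0 \notin S.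
    have [eqH|/neq1[//|a0 a0H na0]] := eqVneq H [set x].
      by exists x => //; rewrite inE eqxx eqH eqxx (negPf nxy).
    exists a0 => //; rewrite inE (negPf na0) /=.
    by apply: contraTN a0H => /andP[/eqP->].
  have [b0 b0L b0S] : exists2 b0, b0 \in ~: H & b0 \notin S.
    have yL' : y \in ~: H by rewrite inE.
    have [eqL|/neq1[//|b0 b0L nb0]] := eqVneq (~: H) [set y].
      by exists y => //; rewrite inE eqxx eqL eqxx eq_sym (negPf nxy).
    exists b0 => //; rewrite inE (negPf nb0) orbF.
    by apply: contraTN b0L => /andP[/eqP-> _]; rewrite inE xH.
  rewrite inE in b0L.
  have [a [b [aH aS bL bS eab]]] := cross_edge cS a0H a0S b0L b0S.
  rewrite -(setUCr H); apply: spanning_path_cat (disjL _ (subxx H)); last exact: eab.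
    apply: clique_spanning_path => // xa; apply/eqP; apply: contraR aS => nH.
    by rewrite inE -xa eqxx nH.
  apply: clique_spanning_path; rewrite ?inE // => by_; apply/eqP.
  by apply: contraR bS => nL; rewrite inE by_ eqxx -by_ nL orbT.
have [L0|/set0Pn[l lL]] := eqVneq (~: H) set0.
  have HT : H = setT by rewrite -[H]setCK L0 setC0.
  rewrite -HT; apply: clique_spanning_path => // xy; by rewrite xy eqxx in nxy.
have lH : l \notin H by rewrite inE in lL.
have notinH z : z \in H -> z != l by apply: contraTneq => ->.
(* Here the path is [x, h .. h', y]. Deleting [y] gives the edge [xh]; deleting [x] and [h] gives
   [yh'] with [h'] distinct from [h]. *)
have [eqH|] := eqVneq H [set x; y].
  have [a [h [aH aS hL hS eah]]] :
      exists a b, [/\ a \in H, a \notin [set y], b \notin H, b \notin [set y] & e a b].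
    by apply: (@cross_edge H [set y] x l) => //; rewrite ?cards1 // !inE // eq_sym notinH.
  have {aS aH} ax : a = x.
    by move: aH aS; rewrite eqH !inE => /orP[/eqP->|/eqP->] //; rewrite eqxx.
  subst a.
  (* A second outside vertex exists since there are more than three vertices. *)
  have [l' l'L nl'] : exists2 l', l' \in ~: H & l' != h.
    apply: neq1; first by rewrite inE.
    apply/negP => /eqP eqL; have := proj1 e_conn.
    by rewrite -(cardsC H) eqL cards1 eqH cards2 nxy.
  rewrite inE in l'L.
  have [a [h' [aH aS h'L h'S eah']]] :
      exists a b, [/\ a \in H, a \notin [set x; h], b \notin H, b \notin [set x; h] & e a b].
    apply: (@cross_edge H [set x; h] y l') => //; rewrite !inE negb_or ?nl' ?andbT.
      by rewrite eq_sym nxy /=; apply: contraNneq hL => <-.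
    by apply: contraNneq l'L => ->.
  have {aS aH} ay : a = y.
    by move: aH aS; rewrite eqH !inE => /orP[/eqP->|/eqP->] //; rewrite eqxx.
  subst a.
  have spanL : spanning_path (~: H) h h'.
    apply: clique_spanning_path; rewrite ?inE // => hh'.
    by rewrite !inE hh' eqxx orbT in h'S.
  have := spanning_path_cat (spanning_path1 x) spanL eah (disjL _ _).
  rewrite sub1set => /(_ xH) span1.
  have := spanning_path_cat span1 (spanning_path1 y).
  rewrite (proj1 e_simple) => /(_ eah').
  rewrite disjoint_sym disjoints1 !inE eq_sym (negPf nxy) yH /= => /(_ isT).
  by rewrite setUAC -eqH setUCr.
move=> nH.
(* A third vertex of [H] survives deleting [x] and [y], so the first crossing edge can avoid
   both. *)
have [z [zH zx zy]] : exists z, [/\ z \in H, z != x & z != y].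
  have : ~~ (H \subset [set x; y]).
    by apply: contra nH => sH; rewrite eqEsubset sH subUset !sub1set xH yH.
  by case/subsetPn => z zH; rewrite !inE negb_or => /andP[? ?]; exists z.
have [a [h [aH aS hL hS eah]]] :
    exists a b, [/\ a \in H, a \notin [set x; y], b \notin H, b \notin [set x; y] & e a b].
  apply: (@cross_edge H [set x; y] z l) => //; rewrite !inE negb_or ?zx //.
  by rewrite eq_sym notinH // eq_sym notinH.
move: aS; rewrite !inE negb_or => /andP[ax ay].
have hL' : h \in ~: H by rewrite inE.
(* The second crossing edge: delete [a] and [h], or only [a] when [h] is the whole other clique. *)
have [b [h' [bH ba h'L h'h ebh']]] :
    exists b h', [/\ b \in H, b != a, h' \notin H, h' = h -> ~: H = [set h] & e b h'].
  have [eqL|/(neq1 _ _ hL')[l' l'L nl']] := eqVneq (~: H) [set h].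
    have [b [h' [bH bS h'L h'S ebh']]] :
        exists a' b, [/\ a' \in H, a' \notin [set a], b \notin H, b \notin [set a] & e a' b].
      apply: (@cross_edge H [set a] x h) => //; rewrite ?cards1 // !inE 1?eq_sym //.
      by apply: contraNneq hL => <-.
    by exists b, h'; split=> //; rewrite inE in bS.
  rewrite inE in l'L.
  have [b [h' [bH bS h'L h'S ebh']]] :
      exists a' b, [/\ a' \in H, a' \notin [set a; h], b \notin H, b \notin [set a; h] & e a' b].
    apply: (@cross_edge H [set a; h] x l') => //; rewrite !inE negb_or ?nl' ?andbT.
      by rewrite eq_sym ax /=; apply: contraNneq hL => <-.
    by apply: contraNneq l'L => ->.
  move: bS h'S; rewrite !inE !negb_or => /andP[? _] /andP[_ /eqP ?].
  by exists b, h'; split.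
have h'L' : h' \in ~: H by rewrite inE.
have span_hh' : spanning_path (~: H) h h'.
  by apply: clique_spanning_path => // /esym.
have span_h'h : spanning_path (~: H) h' h.
  by apply: clique_spanning_path => // /[dup] /h'h + ->.
have subclique (A : {set V}) : A \subset H -> clique A.
  by move=> sA u v /(subsetP sA) uH /(subsetP sA) vH; apply: cH.
have eha : e h a by rewrite (proj1 e_simple).
have eh'b : e h' b by rewrite (proj1 e_simple).
(* [H] is split into a part covered before the sweep of the other clique and a part covered after
   it. *)
have glue (A B : {set V}) c k k' d : A \subset H -> H = A :|: B -> [disjoint A & B] ->
    spanning_path A x c -> spanning_path (~: H) k k' -> spanning_path B d y ->
    e c k -> e k' d -> spanning_path setT x y.
  move=> sA HAB dAB spA spL spB eck ekd.
  have sB : B \subset H by rewrite HAB subsetUr.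
  have := spanning_path_cat (spanning_path_cat spA spL eck (disjL _ sA)) spB ekd.
  rewrite disjoints_subset subUset -!disjoints_subset dAB disjoint_sym disjL //= => /(_ isT).
  by rewrite setUAC -HAB setUCr.
(* If [b = y], the route is [x .. a, h .. h', y]. *)
have [byE|nby] := eqVneq b y.
  apply: (glue (H :\ y) [set y] a h h' b) => //.
  - exact: subsetDl.
  - by rewrite setUC setD1K.
  - by rewrite disjoint_sym disjoints1 !inE eqxx.
  - apply: clique_spanning_path; rewrite ?inE ?xH ?aH ?nxy ?ay //.
      by apply: subclique; exact: subsetDl.
    by move=> xa; rewrite xa eqxx in ax.
  - by rewrite byE; apply: spanning_path1.
(* If [b = x], the route is [x, h' .. h, a .. y]. *)
have [bxE|nbx] := eqVneq b x.
  apply: (glue [set x] (H :\ x) x h' h a) => //.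
  - by rewrite sub1set.
  - by rewrite setD1K.
  - by rewrite disjoints1 !inE eqxx.
  - exact: spanning_path1.
  - apply: clique_spanning_path; rewrite ?inE ?yH ?aH ?ax 1?eq_sym ?nxy //.
      by apply: subclique; exact: subsetDl.
    by move=> xa; rewrite xa eqxx in ay.
  - by rewrite -bxE.
(* Otherwise the route is [x .. b, h' .. h, a, y]. *)
apply: (glue (H :\: [set a; y]) [set a; y] b h' h a) => //.
- exact: subsetDl.
- by rewrite setUC -{1}(setID H [set a; y]) (setIidPr _) // subUset !sub1set aH yH.
- by rewrite disjoints_subset setDE subsetIr.
- apply: clique_spanning_path; rewrite ?inE ?negb_or ?xH ?bH ?nxy ?ba ?nby 1?eq_sym ?ax //.
    by apply: subclique; exact: subsetDl.
  by move=> xb; rewrite xb eqxx in nbx.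
- apply: clique_spanning_path; rewrite ?inE ?eqxx ?orbT //.
    by apply: subclique; rewrite subUset !sub1set aH yH.
  by move=> eay; rewrite eay eqxx in ay.
Qed.

End TwoCliques.

(** * The degree-sum bound and the induction on missing edges *)

Lemma bigminn_geq (I : eqType) (r : seq I) (P : pred I) (F : I -> nat) m i :
  i \in r -> P i -> \big[minn/m]_(j <- r | P j) F j <= F i.
Proof.
elim: r => //= j r IH; rewrite inE big_cons => /orP[/eqP <- -> | ir Pi].
  exact: geq_minl.
by case: ifP => _; rewrite ?geq_min IH ?orbT.
Qed.

Lemma le_sigma2 (V : finType) (e : rel V) k u v :
  le_ext k (sigma2 e) -> u != v -> ~~ e u v -> k <= deg e u + deg e v.
Proof.
rewrite /sigma2; case: ifP => [/forallP/(_ u)/forallP/(_ v)/implyP compl _ /compl->//|_].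
move=> /= le_k nuv neuv; apply: leq_trans le_k _.
by apply: (@bigminn_geq _ _ _ (fun p => deg e p.1 + deg e p.2) _ (u, v));
  rewrite ?mem_index_enum //= nuv.
Qed.

(** With [s] and [t] fixed, every hypothesis survives adding edges, and each added edge lowers the
    number of ordered nonadjacent pairs, on which the induction runs. *)
Lemma bip_hole_free_ham (V : finType) (e : rel V) s t x y :
    simple_graph e -> k_connected e 3 -> 0 < s -> 0 < t ->
    ~~ has_bip_hole e s t ->
    (forall u v, u != v -> ~~ e u v -> (s + t <= deg e u) || (s + t <= deg e v)) ->
    x != y ->
  exists p, ham_path e x y p.
Proof.
move=> + + s0 t0 + + nxy.
have [m] := ubnP #|[set p : V * V | ~~ e p.1 p.2]|.
elim: m e => // m IH e ltm e_simple e_conn no_hole ore.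
pose H := [set v | s + t <= deg e v].
have [/existsP[u /existsP[v /and4P[degu degv nuv neuv]]]|/existsPn cH] :=
  boolP [exists u, exists v, [&& s + t <= deg e u, s + t <= deg e v, u != v & ~~ e u v]].
  have [p] : exists p, ham_path (add_edge e u v) x y p.
    have sub := @sub_add_edge _ e u v.
    apply: IH.
    - rewrite ltnS in ltm; apply: leq_trans ltm; apply/proper_card/properP; split.
        by apply/subsetP=> p; rewrite !inE; apply/contra/sub.
      by exists (u, v); rewrite !inE /= ?neuv // /add_edge /= !eqxx orbT.
    - exact: add_edge_simple.
    - exact: sub_k_connected sub e_conn.
    - by apply: contra no_hole; apply: sub_has_bip_hole.
    - move=> a b nab neab; have /orP[dega|degb] := ore a b nab (contra (@sub a b) neab).
        by apply/orP; left; apply: leq_trans dega (deg_add_edge _ _ _ _).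
      by apply/orP; right; apply: leq_trans degb (deg_add_edge _ _ _ _).
  exact: (ham_path_add_edge e_simple nxy neuv s0 t0 no_hole degu degv).
apply: (@two_cliques_ham _ _ e_simple e_conn H) => //.
  move=> u v; rewrite !inE => degu degv nuv; apply/negPn/negP => neuv.
  by move/existsPn/(_ v): (cH u); rewrite degu degv nuv neuv.
move=> u v; rewrite !inE => degu degv nuv; apply/negPn/negP => neuv.
by move: (ore u v nuv neuv); rewrite (negPf degu) (negPf degv).
Qed.

Theorem mainTheorem3 (V : finType) (e : rel V) :
  simple_graph e -> k_connected e 3 ->
  le_ext (2 * bhn e + 1) (sigma2 e) ->
  hamiltonian_connected e.
Proof.
move=> e_simple e_conn; rewrite /bhn; case: ex_minnP => k.
case/existsP=> s /existsP[t /and4P[s0 t0 /eqP st no_hole]] _ ore x y.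
apply: (@bip_hole_free_ham V e s t) => // u v nuv neuv.
(* Since [k = s + t - 1], the degree sum is at least [2 * (s + t) - 1], so one of the two degrees
   reaches [s + t]. *)
by have := le_sigma2 ore nuv neuv; rewrite st; lia.
Qed.
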